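(* Let $S$ be a finite set with $|S|=n$ and $\mathcal F\subseteq 2^S$. Suppose that for every $1\le k\le n$ there is an algorithm $\mathcal A(k)$ that enumerates all sets in $\mathcal F$ of cardinality at least $k$ with delay at most $t(n)$ and space at most $s(n)$. Then there is an algorithm that enumerates all sets in $\mathcal F$ in non-increasing order of cardinality, outputting the first $i$ solutions in $O(i\cdot n\cdot t(n))$ time for every $i\le|\mathcal F|$, and using $O(s(n))$ space.
   Context: Delay is the maximum time elapsed between two consecutive outputs, including preprocessing and post-processing. *)

(* Defs.v *)
From HB Require Import structures.
From mathcomp Require Import all_boot.

Set Implicit Arguments.
Unset Strict Implicit.
Unset Printing Implicit Defensive.

(** Machine model: a word RAM with [w]-bit words, a read-only input [x], a
    write-only output, finitely many registers and finitely many growable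
    arrays of words, initially 0.  A program is a finite flow graph; each
    instruction costs one time unit.  The two registers [arg0] and [arg1]
    initially hold the arguments.  Arithmetic is modulo [2 ^ w], with
    truncated subtraction. *)

Inductive binop := Add | Sub | Mul | Div | Mod.

Definition eval_binop (o : binop) : nat -> nat -> nat :=
  match o with
  | Add => addn | Sub => subn | Mul => muln | Div => divn | Mod => modn
  end.

Inductive instr (label reg arr : Type) :=
  | Const of reg & nat & label            (* r := v *)
  | Op of binop & reg & reg & reg & label (* r := a op b *)
  | IfLt of reg & reg & label & label     (* branch on a < b *)
  | IfEq of reg & reg & label & label     (* branch on a = b *)
  | Input of reg & reg & label            (* r := x[a] *)
  | Get of reg & arr & reg & label        (* r := M[a] *)
  | Put of arr & reg & reg & label        (* M[a] := r *)
  | Emit of reg & label                   (* next element of the current set *)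
  | Flush of label                        (* the current set is complete *)
  | Halt.

Record program := Program {
  label : finType;
  reg : finType;
  arr : finType;
  start : label;
  arg0 : reg;
  arg1 : reg;
  code : label -> instr label reg arr
}.

Section Semantics.

Variable p : program.

(** [pc = None] means halted.  [cur] is the part of the current set emitted so
    far.  [clock] and [log] cannot be read by the program: [clock] counts the
    executed instructions, and [log] lists the sets output so far, each with the
    value of [clock] at its completion. *)
Record config := Config {
  pc : option (label p);
  regs : {ffun reg p -> nat};
  mem : {ffun arr p -> seq nat};
  cur : seq nat;
  clock : nat;
  log : seq (nat * seq nat)
}.

Definition upd (I : finType) (T : Type) (f : {ffun I -> T}) (i : I) (v : T) :
  {ffun I -> T} := [ffun j => if j == i then v else f j].

Definition word (w v : nat) : nat := v %% 2 ^ w.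

Definition init (w : nat) (args : seq nat) : config :=
  Config (Some (start p))
    [ffun r => word w (if r == arg0 p then nth 0 args 0
                       else if r == arg1 p then nth 0 args 1 else 0)]
    [ffun=> [::]] [::] 0 [::].

Definition step (w : nat) (x : seq nat) (c : config) : config :=
  let: Config pc0 R M u T H := c in
  match pc0 with
  | None => c
  | Some l =>
    match code l with
    | Const r v l' => Config (Some l') (upd R r (word w v)) M u T.+1 H
    | Op o r a b l' =>
        Config (Some l') (upd R r (word w (eval_binop o (R a) (R b)))) M u T.+1 H
    | IfLt a b l1 l2 => Config (Some (if R a < R b then l1 else l2)) R M u T.+1 H
    | IfEq a b l1 l2 => Config (Some (if R a == R b then l1 else l2)) R M u T.+1 H
    | Input r a l' => Config (Some l') (upd R r (word w (nth 0 x (R a)))) M u T.+1 H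
    | Get r m a l' => Config (Some l') (upd R r (nth 0 (M m) (R a))) M u T.+1 H
    | Put m a r l' =>
        Config (Some l') R (upd M m (set_nth 0 (M m) (R a) (R r))) u T.+1 H
    | Emit r l' => Config (Some l') R M (rcons u (R r)) T.+1 H
    | Flush l' => Config (Some l') R M [::] T.+1 (rcons H (T.+1, u))
    | Halt => Config None R M u T.+1 H
    end
  end.

(** Output emitted after the last [Flush] would belong to no set, hence the
    condition on [cur]. *)
Definition terminates (w : nat) (x args : seq nat) (c : config) : Prop :=
  [/\ exists j, c = iter j (step w x) (init w args), pc c = None & cur c = [::]].

Definition out_times (c : config) : seq nat := [seq e.1 | e <- log c].

(** Delay of a terminated run [c]: the largest gap in the sequence consisting of
    time 0, the output times, and the halting time. *)
Definition delay (c : config) : nat :=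
  \max_(d <- pairmap (fun a b => b - a) 0 (rcons (out_times c) (clock c))) d.

(** Number of words.  [set_nth] never shrinks an array, so an array's final size
    is one more than the highest address ever written to it, and the final value
    of [space] is its maximum over the run. *)
Definition space (c : config) : nat := #|reg p| + \sum_(a : arr p) size (mem c a).

(** The ground set is ['I_n]; a set is output by emitting each of its elements
    exactly once, in any order. *)
Definition spells (n : nat) (l : seq nat) (X : {set 'I_n}) : bool :=
  perm_eq l [seq val i | i <- enum X].

(** The output of [c] is the sequence of sets [Xs], and [Xs] lists [G] without
    repetition. *)
Definition outputs (n : nat) (c : config) (G : {set {set 'I_n}})
    (Xs : seq {set 'I_n}) : bool :=
  all2 (@spells n) [seq e.2 | e <- log c] Xs && perm_eq Xs (enum G).

End Semantics.

(** [A], run on the input [x] with arguments [args], enumerates [G] with delay at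
    most [t] and space at most [s]. *)
Definition enumerates_within (A : program) (w : nat) (x args : seq nat) (n : nat)
    (G : {set {set 'I_n}}) (t s : nat) : Prop :=
  exists (c : config A) (Xs : seq {set 'I_n}),
    [/\ terminates w x args c, outputs c G Xs, delay c <= t & space c <= s].

Definition at_least (n k : nat) (F : {set {set 'I_n}}) : {set {set 'I_n}} :=
  [set X in F | k <= #|X|].

Definition nonincreasing_card (n : nat) (Xs : seq {set 'I_n}) : bool :=
  sorted (fun X Y : {set 'I_n} => #|Y| <= #|X|) Xs.

(* Main.v *)
Require Import Defs.
From HB Require Import structures.
From mathcomp Require Import all_boot zify.

Set Implicit Arguments.
Unset Strict Implicit.
Unset Printing Implicit Defensive.

(** Run [A(k)] for [k = n, ..., 1], keeping only the sets of cardinality exactly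
    [k], and output the empty set, if it belongs to the family, at the end.  When
    the [i]-th set, of cardinality [k], is output, every [A(j)] with [j > k] has
    found fewer than [i] sets, and [A(k)] at most [i], so each of these at most [n]
    runs has taken time [O(i * t)].

    There may be no room for buffering the current set until its cardinality is
    known.  So two copies of [A] run in alternation: a scout only counts the
    elements of the next set, and a replay then executes the same instructions,
    emitting the set iff the count is [k].  There is no time for clearing the
    arrays between two runs either: every cell carries a stamp with the value of
    [k] at its last write, and reads as 0 when the stamp is outdated. *)

Lemma updE (I : finType) (T : Type) (f : {ffun I -> T}) i v j :
  upd f i v j = if j == i then v else f j.
Proof. by rewrite ffunE. Qed.

Lemma word_small w v : v < 2 ^ w -> word w v = v.
Proof. exact: modn_small. Qed.

(** * Runs of a program *)

Section Runs.

Variables (p : program) (w : nat) (x : seq nat).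
Implicit Types c : config p.
Local Notation step := (@step p w x).

Definition reaches c c' := exists j, c' = iter j step c.

Lemma reaches_refl c : reaches c c.
Proof. by exists 0. Qed.

Lemma reaches_step c : reaches c (step c).
Proof. by exists 1. Qed.

Lemma reaches_trans c2 c1 c3 : reaches c1 c2 -> reaches c2 c3 -> reaches c1 c3.
Proof. by move=> [i ->] [j ->]; exists (j + i); rewrite iterD. Qed.

(** [Flush] and [Halt] are the only points where control passes between the scout and the replay, so
    runs of [A] are cut there. *)
Definition quiet (i : instr (label p) (reg p) (arr p)) :=
  match i with Flush _ | Halt => false | _ => true end.

Definition quiet_at c := if pc c is Some l then quiet (code l) else false.

Lemma step_quiet c : quiet_at c -> log (step c) = log c /\ pc (step c) <> None.
Proof. by case: c => [[l|]] //= R M u T H; rewrite /quiet_at /=; case: (code l). Qed.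

Lemma iter_quiet d c : (forall i, i < d -> quiet_at (iter i step c)) ->
  log (iter d step c) = log c.
Proof.
elim: d => //= d IH q; have [-> _] := step_quiet (q d (leqnn _)).
by apply: IH => i id; apply: q; apply: leqW.
Qed.

Lemma iter_halted j c : pc c = None -> iter j step c = c.
Proof.
move=> h; elim: j => //= j ->.
by case: c h => pc0 R M u T H /= ->.
Qed.

Lemma iter_halted_eq i j c : pc (iter i step c) = None ->
  pc (iter j step c) = None -> iter i step c = iter j step c.
Proof.
wlog ij : i j / i <= j.
  by case/orP: (leq_total i j) => ij W hi hj; [|symmetry]; apply: W.
by move=> hi _; rewrite -[in RHS](subnK ij) iterD [RHS]iter_halted.
Qed.

Lemma first_loud J c : pc (iter J step c) = None -> pc c <> None ->
  exists d, [/\ d < J, forall i, i < d -> quiet_at (iter i step c),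
    ~~ quiet_at (iter d step c) & pc (iter d step c) <> None].
Proof.
elim: J c => [|J IH] c //; rewrite iterSr => hJ hc.
have [q|nq] := boolP (quiet_at c); last by exists 0.
have [_ hs] := step_quiet q; have [d [dJ qs nq hd]] := IH _ hJ hs.
exists d.+1; rewrite !iterSr; split=> // -[|i] // id.
by rewrite iterSr; apply: qs.
Qed.

Lemma step_mono c : [/\ forall m, size (Defs.mem c m) <= size (Defs.mem (step c) m),
  {subset log c <= log (step c)} & clock c <= clock (step c)].
Proof.
case: c => [[l|]] R M u T H /=; last by split.
case: (code l) => //=; try by intros; split.
- move=> m a r l'; split=> // q; rewrite updE; case: eqP => // ->.
  by rewrite size_set_nth leq_maxr.
- by move=> l'; split=> // y yH; rewrite mem_rcons inE yH orbT.
Qed.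

Lemma iter_mono j c :
  [/\ forall m, size (Defs.mem c m) <= size (Defs.mem (iter j step c) m),
  {subset log c <= log (iter j step c)} & clock c <= clock (iter j step c)].
Proof.
elim: j => [|j [IHm IHl IHc]] /=; first by split.
have [hm hl hc] := step_mono (iter j step c).
split=> [m|y /IHl /hl //|]; first exact: leq_trans (hm m).
exact: leq_trans hc.
Qed.

(** A halted configuration is a fixed point, so [i] may exceed [J]. This carries bounds known for
    the final configuration back to every moment of the run. *)
Lemma run_mono i J c (z := iter J step c) : pc z = None ->
  [/\ forall m, size (Defs.mem (iter i step c) m) <= size (Defs.mem z m),
      {subset log (iter i step c) <= log z} &
      clock (iter i step c) <= clock z].
Proof.
move=> h; case: (leqP i J) => [iJ|/ltnW Ji].
  by rewrite /z -(subnK iJ) iterD; apply: iter_mono.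
by rewrite -(subnK Ji) iterD (iter_halted _ h); split.
Qed.

End Runs.

(** * Output times from the delay, and filtered lists of sets *)

Lemma nth_pairmap_max t a s :
  \max_(d <- pairmap (fun a b => b - a) a s) d <= t ->
  forall q, q < size s -> nth 0 s q <= a + q.+1 * t.
Proof.
elim: s a => //= b s IH a; rewrite big_cons geq_max => /andP[h1 h2] [|q] /= hq.
  lia.
have := IH b h2 q hq; lia.
Qed.

Lemma delay_bounds (p : program) (c : config p) t : delay c <= t ->
  (forall q, q < size (log c) -> nth 0 (out_times c) q <= q.+1 * t) /\
  clock c <= (size (log c)).+1 * t.
Proof.
move=> h; have H := nth_pairmap_max h.
have sz : size (out_times c) = size (log c) by rewrite size_map.
split=> [q hq|].
  have := H q; rewrite size_rcons sz nth_rcons sz hq add0n; apply; lia.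
have := H (size (log c)); rewrite size_rcons sz nth_rcons sz ltnn eqxx add0n.
by apply.
Qed.

(** Only rejected entries can separate the two positions. Applied to the log of [A(k)], the rejected
    entries are the larger sets, which have already been output. *)
Lemma nth_filter (T : Type) (x0 : T) (a : pred T) (s : seq T) i :
  i < count a s -> exists2 q, q < size s &
    q <= i + count (predC a) s /\ nth x0 (filter a s) i = nth x0 s q.
Proof.
elim: s i => //= y s IH i; case: (a y) => /= h.
  case: i h => [_|i h]; first by exists 0.
  have [q qs [hq e]] := IH i h; exists q.+1 => //; split=> //=; lia.
have [q qs [hq e]] := IH i h; exists q.+1 => //; split=> //=; lia.
Qed.

Lemma all2_cat (S T : Type) (r : S -> T -> bool) s1 s2 t1 t2 :
  all2 r s1 t1 -> all2 r s2 t2 -> all2 r (s1 ++ s2) (t1 ++ t2).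
Proof.
by move=> + h; elim: s1 t1 => [|y s1 IH] [|z t1] //= /andP[-> /IH].
Qed.

Lemma spells_size n l (X : {set 'I_n}) : spells l X -> size l = #|X|.
Proof. by move/perm_size->; rewrite size_map cardE. Qed.

Lemma all2_spells_filter n k us (Xs : seq {set 'I_n}) : all2 (@spells n) us Xs ->
  all2 (@spells n) [seq u <- us | size u == k] [seq X : {set 'I_n} <- Xs | #|X| == k].
Proof.
elim: us Xs => [|u us IH] [|X Xs] //= /andP[uX /IH h].
by rewrite (spells_size uX); case: ifP => //=; rewrite uX.
Qed.

Lemma all2_spells_count n k us (Xs : seq {set 'I_n}) : all2 (@spells n) us Xs ->
  count (fun u => size u != k) us = count (fun X : {set 'I_n} => #|X| != k) Xs.
Proof.
elim: us Xs => [|u us IH] [|X Xs] //= /andP[uX /IH ->].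
by rewrite (spells_size uX).
Qed.

Lemma mem_at_least n k (F : {set {set 'I_n}}) X :
  (X \in at_least k F) = (X \in F) && (k <= #|X|).
Proof. by rewrite inE. Qed.

Lemma perm_at_least n k (F : {set {set 'I_n}}) Xs Ys :
  perm_eq Xs (enum (at_least k F)) -> perm_eq Ys (enum (at_least k.+1 F)) ->
  perm_eq (Ys ++ [seq X : {set 'I_n} <- Xs | #|X| == k]) (enum (at_least k F)).
Proof.
move=> pX pY; apply: uniq_perm; last 1 first.
- move=> X; rewrite mem_cat mem_filter (perm_mem pX) (perm_mem pY) !mem_enum.
  rewrite !mem_at_least; case: (X \in F) => //=; lia.
- rewrite cat_uniq filter_uniq ?(perm_uniq pX) ?(perm_uniq pY) ?enum_uniq //=.
  rewrite andbT; apply/hasPn => X; rewrite mem_filter => /andP[/eqP Xk _].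
  by rewrite (perm_mem pY) mem_enum mem_at_least Xk ltnn andbF.
exact: enum_uniq.
Qed.

Lemma nonincreasing_cat n k (Ys Zs : seq {set 'I_n}) : nonincreasing_card Ys ->
  {in Ys, forall X : {set 'I_n}, k <= #|X|} ->
  {in Zs, forall X : {set 'I_n}, #|X| = k} -> nonincreasing_card (Ys ++ Zs).
Proof.
have tr : transitive (fun X Y : {set 'I_n} => #|Y| <= #|X|).
  by move=> X Y Z /= XY YZ; apply: leq_trans YZ XY.
rewrite /nonincreasing_card !sorted_pairwise // pairwise_cat => -> hY hZ.
rewrite andTb; apply/andP; split.
  by apply/allrelP => X Y XY YZ; rewrite (hZ Y YZ) hY.
elim: Zs hZ => //= Z Zs IH hZ; apply/andP; split; last first.
  by apply: IH => X XZ; apply: hZ; rewrite inE XZ orbT.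
by apply/allP => X XZ; rewrite !hZ ?mem_head // inE XZ orbT.
Qed.

(** * The enumerator *)

Section Enumerator.

Variable A : program.

(** [Card] is the cardinality currently enumerated, and [Count] the number of
    elements emitted by the scout since its last [Flush]. *)
Inductive aux_reg := Size | Card | Count | One | Stamp.

Definition aux_reg_code r : 'I_5 :=
  match r with
  | Size => @Ordinal 5 0 isT
  | Card => @Ordinal 5 1 isT
  | Count => @Ordinal 5 2 isT
  | One => @Ordinal 5 3 isT
  | Stamp => @Ordinal 5 4 isT
  end.
Definition aux_reg_decode (i : 'I_5) :=
  match val i with 0 => Size | 1 => Card | 2 => Count | 3 => One | _ => Stamp end.
Lemma aux_reg_codeK : cancel aux_reg_code aux_reg_decode.
Proof. by case. Qed.
HB.instance Definition _ := Finite.copy aux_reg (can_type aux_reg_codeK).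

(** Mode [None] runs the scout; mode [Some e] runs the replay, which emits iff
    [e]. *)
Inductive enum_label :=
  | Boot of bool
  | Reset of {set bool * reg A}
  | Sim of option bool & label A & label A & bool * bool
  | Next
  | Fin of bool.

Definition label_code l :
    bool + {set bool * reg A} +
    (option bool * label A * label A * (bool * bool)) + option bool :=
  match l with
  | Boot b => inl (inl (inl b))
  | Reset D => inl (inl (inr D))
  | Sim md ls le u => inl (inr (md, ls, le, u))
  | Next => inr None
  | Fin b => inr (Some b)
  end.
Definition label_decode c :=
  match c with
  | inl (inl (inl b)) => Boot b
  | inl (inl (inr D)) => Reset D
  | inl (inr (md, ls, le, u)) => Sim md ls le u
  | inr None => Next
  | inr (Some b) => Fin b
  end.
Lemma label_codeK : cancel label_code label_decode.
Proof. by case. Qed.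
HB.instance Definition _ := Finite.copy enum_label (can_type label_codeK).

Definition enum_reg : finType := (bool * reg A + aux_reg)%type.
(** [(b, true, m)] holds, for each cell of [(b, false, m)], the value of [Card]
    at the last write; a cell with an outdated stamp counts as 0. *)
Definition enum_arr : finType := (bool * bool * arr A)%type.
Definition aux (r : aux_reg) : enum_reg := inr r.
Definition enum_instr := instr enum_label enum_reg enum_arr.

Definition goto (md : option bool) (ls le l : label A) : enum_label :=
  if md is None then Sim None l le (false, false)
  else Sim md ls l (false, false).

(** [u] is the position inside an instruction that takes several steps: [Get] loads the stamp,
    compares it with [Card], then reads the cell or yields 0; [Put] writes the value, then the
    stamp. The replay stops at the [Flush] where the scout handed over, so only the scout meets
    [Halt]. *)
Definition sim_code (md : option bool) (ls le : label A) (u : bool * bool) :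
    enum_instr :=
  let b := isSome md in
  let R (r : reg A) : enum_reg := inl (b, r) in
  let at_ u' := Sim md ls le u' in
  let go := goto md ls le in
  match code (if b then le else ls) with
  | Const r v l => Const _ (R r) v (go l)
  | Op o r a a' l => Op _ o (R r) (R a) (R a') (go l)
  | IfLt a a' l1 l2 => IfLt _ (R a) (R a') (go l1) (go l2)
  | IfEq a a' l1 l2 => IfEq _ (R a) (R a') (go l1) (go l2)
  | Input r a l => Input _ (R r) (R a) (go l)
  | Get r m a l =>
    match u with
    | (false, false) => Get (aux Stamp) (b, true, m) (R a) (at_ (false, true))
    | (false, true) =>
        IfEq _ (aux Stamp) (aux Card) (at_ (true, false)) (at_ (true, true))
    | (true, false) => Get (R r) (b, false, m) (R a) (go l)
    | (true, true) => Const _ (R r) 0 (go l)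
    end
  | Put m a r l =>
    if u == (false, false) then Put (b, false, m) (R a) (R r) (at_ (false, true))
    else Put (b, true, m) (R a) (aux Card) (go l)
  | Emit r l =>
    match md with
    | None => Op _ Add (aux Count) (aux Count) (aux One) (go l)
    | Some true => Emit _ (R r) (go l)
    | Some false => Const _ (aux Stamp) 0 (go l)
    end
  | Flush l =>
    match md with
    | None => IfEq _ (aux Count) (aux Card)
                (Sim (Some true) l le (false, false))
                (Sim (Some false) l le (false, false))
    | Some e =>
      if e && (u == (false, false)) then Flush _ _ (at_ (false, true))
      else Const _ (aux Count) 0 (Sim None ls l (false, false))
    end
  | Halt =>
    if b then Halt _ _ _ else IfEq _ (aux Card) (aux One) (Fin false) Next
  end.

(** The registers still to be reset are stored in the label, so the loop needs no counter and its
    length depends on [A] only. *)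
Definition reset_code (D : {set bool * reg A}) : enum_instr :=
  if [pick r in D] is Some r then
    let l := Reset (D :\ r) in
    if r.2 == arg0 A then Op _ Mul (inl r : enum_reg) (aux Size) (aux One) l
    else if r.2 == arg1 A then Op _ Mul (inl r : enum_reg) (aux Card) (aux One) l
    else Const _ (inl r : enum_reg) 0 l
  else Const _ (aux Stamp) 0 (Sim None (start A) (start A) (false, false)).

(** Multiplication by [One] serves as a register copy. The flag [empty] is built into the program
    because the runs [A(k)] with [k >= 1] never report the empty set. *)
Definition enum_code (empty : bool) (l : enum_label) : enum_instr :=
  match l with
  | Boot false => Const _ (aux One) 1 (Boot true)
  | Boot true => Op _ Mul (aux Card) (aux Size) (aux One) (Reset setT)
  | Reset D => reset_code D
  | Sim md ls le u => sim_code md ls le u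
  | Next => Op _ Defs.Sub (aux Card) (aux Card) (aux One) (Reset setT)
  | Fin false => if empty then Flush _ _ (Fin true) else Halt _ _ _
  | Fin true => Halt _ _ _
  end.

Definition enumerator (empty : bool) : program :=
  @Program enum_label enum_reg enum_arr (Boot false) (aux Size) (aux Size)
    (enum_code empty).

(** * Correctness and resource bounds *)

Section Correctness.

Variables (empty : bool) (w : nat) (x : seq nat) (n s : nat).
Hypotheses (n_gt0 : 0 < n) (n_word : n < 2 ^ w).
Local Notation B := (enumerator empty).
Local Notation stepA := (@step A w x).
Local Notation stepB := (@step B w x).
Local Notation reachesB := (@reaches B w x).
Implicit Types (c : config B) (k : nat).
Implicit Types (R : {ffun enum_reg -> nat}) (M : {ffun enum_arr -> seq nat}).

(** * The simulation invariant *)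

Definition mirrors_regs (b : bool) (Ra : {ffun reg A -> nat}) R :=
  forall r, R (inl (b, r)) = Ra r.

(** Arrays are compared cell by cell through [nth] with default 0, since arrays left over from
    earlier phases may be longer than the simulated ones. *)
Definition mirrors_mem k (b : bool) (Ma : {ffun arr A -> seq nat}) M :=
  forall m i, nth 0 (Ma m) i =
    if nth 0 (M (b, true, m)) i == k then nth 0 (M (b, false, m)) i else 0.

(** [Card] only decreases, so each stamp is 0 (never written) or the [Card] of this or an earlier
    phase. *)
Definition fresh k M := forall b m i,
  nth 0 (M (b, true, m)) i = 0 \/ k <= nth 0 (M (b, true, m)) i.

Definition bounded M := forall q, size (M q) <= s.

Definition steady k R := [/\ R (aux Size) = n, R (aux Card) = k & R (aux One) = 1].

Lemma mirrors_regs_upd b b' Ra R r v : mirrors_regs b Ra R ->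
  mirrors_regs b (if b == b' then upd Ra r v else Ra) (upd R (inl (b', r)) v).
Proof.
move=> h q; rewrite updE.
rewrite (_ : (inl (b, q) == inl (b', r) :> enum_reg) = (b == b') && (q == r)) //.
by have [_|_] := eqVneq b b'; rewrite /= ?updE h.
Qed.

Lemma mirrors_regs_aux b Ra R r v : mirrors_regs b Ra R ->
  mirrors_regs b Ra (upd R (aux r) v).
Proof. by move=> h q; rewrite updE; apply: h. Qed.

Lemma mirrors_mem_put k b b' Ma M m i v : mirrors_mem k b Ma M ->
  mirrors_mem k b (if b == b' then upd Ma m (set_nth 0 (Ma m) i v) else Ma)
    (upd (upd M (b', false, m) (set_nth 0 (M (b', false, m)) i v)) (b', true, m)
      (set_nth 0 (M (b', true, m)) i k)).
Proof.
move=> h q j; rewrite !updE !xpair_eqE !eqxx /=; have [<-|ne] := eqVneq b b'.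
  rewrite /= updE; have [_|_] := eqVneq q m; last exact: h.
  by rewrite !nth_set_nth /=; case: (eqVneq j i) => _; rewrite ?eqxx ?h.
by rewrite /= h.
Qed.

Lemma fresh_put k M b m i v : fresh k M ->
  fresh k (upd (upd M (b, false, m) v) (b, true, m) (set_nth 0 (M (b, true, m)) i k)).
Proof.
move=> h b' m' j; rewrite !updE; case: eqP => _.
  by rewrite nth_set_nth /=; case: eqP => _; [right|apply: h].
by rewrite !xpair_eqE /= andbF; apply: h.
Qed.

(** The size of the simulated array after the write shows that the address [i] is below [s]; value
    and stamp go to that same address. *)
Lemma bounded_put k Ma M b m i v : bounded M ->
    (forall m', size (upd Ma m (set_nth 0 (Ma m) i v) m') <= s) ->
  bounded (upd (upd M (b, false, m) (set_nth 0 (M (b, false, m)) i v)) (b, true, m)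
    (set_nth 0 (M (b, true, m)) i k)).
Proof.
move=> h /(_ m); rewrite updE eqxx size_set_nth geq_max => /andP[hi _] q.
by rewrite !updE; do 2 (case: eqP => // _; first by rewrite size_set_nth geq_max hi h).
Qed.

Lemma steady_upd k R r v : steady k R -> steady k (upd R (inl r) v).
Proof. by case=> *; split; rewrite updE. Qed.

Lemma steady_stamp k R v : steady k R -> steady k (upd R (aux Stamp) v).
Proof. by case=> *; split; rewrite updE. Qed.

Lemma steady_count k R v : steady k R -> steady k (upd R (aux Count) v).
Proof. by case=> *; split; rewrite updE. Qed.

(** The scout stands at [sc] and the replay at [re]. [T] is a time offset for the phase, and 3 is
    the cost of the slowest simulated instruction, [Get]. [Count] is known only modulo [2 ^ w] until
    a [Flush] bounds the size of the set. *)
Record joint k (md : option bool) (sc re : config A) L T c : Prop := Joint {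
  joint_steady : steady k (regs c);
  joint_fresh : fresh k (Defs.mem c);
  joint_bounded : bounded (Defs.mem c);
  joint_regs0 : mirrors_regs false (regs sc) (regs c);
  joint_regs1 : mirrors_regs true (regs re) (regs c);
  joint_mem0 : mirrors_mem k false (Defs.mem sc) (Defs.mem c);
  joint_mem1 : mirrors_mem k true (Defs.mem re) (Defs.mem c);
  joint_count : md = None -> regs c (aux Count) = word w (size (cur sc));
  joint_cur : cur c = if md is Some true then cur re else [::];
  joint_log : log c = L;
  joint_clock : clock c <= T + 3 * (clock sc + clock re);
  joint_pc : exists ls le, [/\ pc sc = Some ls, pc re = Some le &
    pc c = Some (Sim md ls le (false, false))]
}.

(** * Simulation of the quiet instructions *)

Lemma upd_other R r r' v : r != r' -> upd R r v r' = R r'.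
Proof. by rewrite updE eq_sym => /negPf->. Qed.

Lemma upd_same R r v : upd R r v r = v.
Proof. by rewrite updE eqxx. Qed.

Lemma sim_get md (ls le : label A) l m a r k R M u t H (b := isSome md) :
    code (if b then le else ls) = Get r m a l -> R (aux Card) = k ->
    let v := nth 0 (M (b, true, m)) (R (inl (b, a))) in
  reachesB (@Config B (Some (Sim md ls le (false, false))) R M u t H)
    (@Config B (Some (goto md ls le l)) (upd (upd R (aux Stamp) v) (inl (b, r))
      (if v == k then nth 0 (M (b, false, m)) (R (inl (b, a))) else 0))
      M u t.+3 H).
Proof.
move=> E hk v; exists 3; do 3 rewrite /= /sim_code /= -/b ?E /=.
rewrite upd_same upd_other // hk -/v.
case: eqP => _; rewrite /= /sim_code /= -/b ?E /= ?upd_other //.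
by rewrite /word mod0n.
Qed.

Lemma sim_put md (ls le : label A) l m a r R M u t H (b := isSome md) :
    code (if b then le else ls) = Put m a r l ->
  reachesB (@Config B (Some (Sim md ls le (false, false))) R M u t H)
    (@Config B (Some (goto md ls le l)) R
      (upd (upd M (b, false, m)
        (set_nth 0 (M (b, false, m)) (R (inl (b, a))) (R (inl (b, r)))))
        (b, true, m) (set_nth 0 (M (b, true, m)) (R (inl (b, a))) (R (aux Card))))
      u t.+2 H).
Proof.
move=> E; exists 2; do 2 rewrite /= /sim_code /= -/b ?E /=.
by rewrite [upd M _ _ (b, true, m)]updE !xpair_eqE /= andbF.
Qed.

Local Ltac close := split=> //=; first
  [ exact: steady_upd | lia
  | exact: (@mirrors_regs_upd true true) | exact: (@mirrors_regs_upd true false)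
  | exact: (@mirrors_regs_upd false true) | exact: (@mirrors_regs_upd false false)
  | by do 2 eexists; split=> //; case: ifP | by rewrite upd_other ].
Local Ltac one_step E h := eexists; [exact: reaches_step|];
  rewrite /= /sim_code /= E /= ?h; close.

(** Case analysis on the instruction of the active copy. The other copy is unaffected, since its
    registers and arrays carry the opposite boolean tag. *)
Lemma joint_step k md sc re L T c (a := if md is Some _ then re else sc) :
  quiet_at a -> (forall m, size (Defs.mem (stepA a) m) <= s) ->
  joint k md sc re L T c ->
  exists2 c', reachesB c c' &
    joint k md (if md is Some _ then sc else stepA sc)
      (if md is Some _ then stepA re else re) L T c'.
Proof.
rewrite /a {a} => q bd [st fr bo h0 h1 m0 m1 hc hu hl ht [ls [le [ps pe pp]]]].
case: c st fr bo h0 h1 m0 m1 hc hu hl ht pp =>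
  pc0 R M u t H /= st fr bo h0 h1 m0 m1 hc hu <- ht ->.
case: sc ps q bd h0 m0 hc ht =>
  pcs Rs Ms us ts Hs /= -> q bd h0 m0 hc ht.
case: re pe q bd h1 m1 hu ht =>
  pce Re Me ue te He /= -> q bd h1 m1 hu ht.
have [hsz hk hone] := st.
set c0 := Config _ _ _ _ _ _.
case: md @c0 q bd hc hu => [e|] c0 /=; rewrite /quiet_at /=.
  case E: (code le) => [r v l|o r a a' l|a a' l1 l2|a a' l1 l2|r a l|r m a l
    |m a r l|r l|l|] //= _ bd hc hu.
  - one_step E h1.
  - one_step E h1.
  - one_step E h1.
  - one_step E h1.
  - one_step E h1.
  - eexists; first by apply: (sim_get (md := Some e)) E hk.
    split=> //=.
    + exact/steady_upd/steady_stamp.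
    + exact/(@mirrors_regs_upd false true)/mirrors_regs_aux.
    + by rewrite h1 -m1; apply/(@mirrors_regs_upd true true)/mirrors_regs_aux.
    + lia.
    + by exists ls, l.
  - eexists; first by apply: (sim_put (md := Some e)) E.
    rewrite /= hk !h1; split=> //=.
    + exact: fresh_put.
    + exact: bounded_put bd.
    + exact: (@mirrors_mem_put _ false true).
    + exact: (@mirrors_mem_put _ true true).
    + lia.
    + by exists ls, l.
  - case: e @c0 hc hu => c0 hc hu; eexists; try exact: reaches_step;
      rewrite /= /sim_code /= E /= ?hu ?h1; split=> //=; try lia.
    1,5: by exists ls, l.
    exact: steady_stamp.
    exact: mirrors_regs_aux.
    exact: mirrors_regs_aux.
case E: (code ls) => [r v l|o r a a' l|a a' l1 l2|a a' l1 l2|r a l|r m a l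
  |m a r l|r l|l|] //= _ bd hc hu.
- one_step E h0.
- one_step E h0.
- one_step E h0.
- one_step E h0.
- one_step E h0.
- eexists; first by apply: (sim_get (md := None)) E hk.
  split=> //=.
  + exact/steady_upd/steady_stamp.
  + by rewrite h0 -m0; apply/(@mirrors_regs_upd false false)/mirrors_regs_aux.
  + exact/(@mirrors_regs_upd true false)/mirrors_regs_aux.
  + by rewrite !upd_other.
  + lia.
  + by exists l, le.
- eexists; first by apply: (sim_put (md := None)) E.
  rewrite /= hk !h0; split=> //=.
  + exact: fresh_put.
  + exact: bounded_put bd.
  + exact: (@mirrors_mem_put _ false false).
  + exact: (@mirrors_mem_put _ true false).
  + lia.
  + by exists l, le.
- eexists; first exact: reaches_step.
  rewrite /= /sim_code /= E /=; split=> //=.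
  + exact: steady_count.
  + exact: mirrors_regs_aux.
  + exact: mirrors_regs_aux.
  + by rewrite upd_same hone hc // size_rcons /word modnDml addn1.
  + lia.
  + by exists l, le.
Qed.


Lemma joint_run d k md sc re L T c (a := if md is Some _ then re else sc) :
  (forall i, i < d -> quiet_at (iter i stepA a)) ->
  (forall i m, size (Defs.mem (iter i stepA a) m) <= s) ->
  joint k md sc re L T c ->
  exists2 c', reachesB c c' &
    joint k md (if md is Some _ then sc else iter d stepA sc)
      (if md is Some _ then iter d stepA re else re) L T c'.
Proof.
rewrite {}/a => q bd J; elim: d q => [|d IH] q.
  by exists c; [apply: reaches_refl | case: (md) J].
have [i id|c1 r1 J1] := IH; first exact/q/leqW.
have [||c2 r2 J2] := joint_step _ _ J1.
- by case: (md) (q d (leqnn _)) => [?|].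
- by case: (md) (bd d.+1) => [?|].
by exists c2; [apply: reaches_trans r2 | case: (md) J2].
Qed.

(** * From one output of [A] to the next *)

Definition flushes_at a := exists l l',
  pc a = Some l /\ code l = @Flush _ (reg A) (arr A) l'.

(** The set has at most [n < 2 ^ w] elements, so [Count] has not wrapped around and its comparison
    with [Card] is exact. *)
Lemma scout_flush k sc re L T c : flushes_at sc -> size (cur sc) <= n ->
  cur re = [::] -> joint k None sc re L T c ->
  exists2 c', reachesB c c' &
    joint k (Some (size (cur sc) == k)) (stepA sc) re L T c'.
Proof.
move=> [l [l' [pl E]]] su ur [st fr bo h0 h1 m0 m1 hc hu hl ht [ls [le [ps pe pp]]]].
have [hsz hk hone] := st.
exists (stepB c); first exact: reaches_step.
have cntE : regs c (aux Count) = size (cur sc).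
  by rewrite hc // word_small // (leq_ltn_trans su).
move: ps; rewrite pl => -[?]; subst l.
case: c st fr bo h0 h1 m0 m1 hc hu hl ht pp hsz hk hone cntE =>
  pc0 R M u t H /= st fr bo h0 h1 m0 m1 hc hu hl ht -> hsz hk hone cntE.
case: sc su pl h0 m0 hc ht cntE =>
  pcs Rs Ms us ts Hs /= su -> h0 m0 hc ht cntE.
rewrite /sim_code /= E /= cntE hk; split=> //=.
- by rewrite hu; case: ifP.
- lia.
- by exists l', le; case: (_ == k).
Qed.

Lemma replay_flush k e sc re L T c : flushes_at re -> cur sc = [::] ->
  joint k (Some e) sc re L T c ->
  exists c' t', [/\ reachesB c c', t' <= T + 3 * (clock sc + clock (stepA re)) &
    joint k None sc (stepA re) (if e then rcons L (t', cur re) else L) T c'].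
Proof.
move=> [l [l' [pl E]]] us [st fr bo h0 h1 m0 m1 hc hu hl ht [ls [le [ps pe pp]]]].
have [hsz hk hone] := st.
move: pe; rewrite pl => -[?]; subst l.
case: c st fr bo h0 h1 m0 m1 hc hu hl ht pp hsz hk hone =>
  pc0 R M u t H /= st fr bo h0 h1 m0 m1 hc hu hl ht -> hsz hk hone.
case: re pl h1 m1 hu ht => pce Re Me ue te He /= -> h1 m1 hu ht.
set c0 := Config _ _ _ _ _ _.
have word0 : word w 0 = 0 by rewrite /word mod0n.
exists (iter (if e then 2 else 1) stepB c0), t.+1.
rewrite E /=; split; [by exists (if e then 2 else 1) | lia |].
case: e @c0 hc hu => c0 _ hu; do 2 rewrite /= /sim_code /= ?E /=.
  split=> //=.
  + exact: steady_count.
  + exact: mirrors_regs_aux.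
  + exact: mirrors_regs_aux.
  + by rewrite upd_same us word0.
  + by rewrite hl hu.
  + lia.
  + by exists ls, l'.
split=> //=.
+ exact: steady_count.
+ exact: mirrors_regs_aux.
+ exact: mirrors_regs_aux.
+ by rewrite upd_same us word0.
+ lia.
+ by exists ls, l'.
Qed.

(** Compares an output [e] with the output [f] of [A] that it reproduces; 6 stands for two copies at
    3 steps per instruction. *)
Definition near T (e f : nat * seq nat) := (e.2 == f.2) && (e.1 <= T + 6 * f.1).

Definition keep k (H : seq (nat * seq nat)) := [seq f <- H | size f.2 == k].

Lemma step_flush a : flushes_at a -> cur (stepA a) = [::] /\
  log (stepA a) = rcons (log a) (clock (stepA a), cur a).
Proof. by case: a => pc0 R M u t H [l [l' /= [-> E]]]; rewrite E. Qed.

(** Both copies start at [a] and [A] is deterministic, so the replay repeats the scout's segment,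
    now knowing the cardinality, and both end at [a']. *)
Lemma cycle d k a L N T c (a' := iter d.+1 stepA a) :
  (forall i, i < d -> quiet_at (iter i stepA a)) -> flushes_at (iter d stepA a) ->
  size (cur (iter d stepA a)) <= n ->
  (forall i m, size (Defs.mem (iter i stepA a) m) <= s) ->
  cur a = [::] -> joint k None a a (L ++ N) T c -> all2 (near T) N (keep k (log a)) ->
  exists c' N', [/\ reachesB c c', joint k None a' a' (L ++ N') T c' &
    all2 (near T) N' (keep k (log a'))].
Proof.
move=> q fl su bd ua J HN.
have [c1 r1 /= J1] := joint_run (md := None) q bd J.
have [c2 r2 /= J2] := scout_flush fl su ua J1.
have [c3 r3 /= J3] := joint_run (md := Some (_ == k)) q bd J2.
have [ua' la'] := step_flush fl.
have [c4 [t' [r4 ht' /= J4]]] := replay_flush fl ua' J3.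
have la : log (iter d stepA a) = log a := iter_quiet q.
exists c4, (if size (cur (iter d stepA a)) == k
  then rcons N (t', cur (iter d stepA a)) else N); split.
- exact/(reaches_trans r1)/(reaches_trans r2)/(reaches_trans r3).
- by move: J4; case: ifP => _ //; rewrite rcons_cat.
- rewrite /a' /= la' la /keep filter_rcons /=; case: ifP => // _.
  rewrite -!cats1 all2_cat //= andbT /near eqxx /=; lia.
Qed.

(** * A whole run of [A(k)] *)

Definition idle k f c := [/\ steady k (regs c), fresh f (Defs.mem c),
  bounded (Defs.mem c), regs c (aux Count) = 0 & cur c = [::]].

Definition halts_at a := exists l, pc a = Some l /\ code l = @Halt _ (reg A) (arr A).

Lemma loud_cases a : pc a <> None -> ~~ quiet_at a -> flushes_at a \/ halts_at a.
Proof.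
case: a => [[l|]] R M u t H // _.
rewrite /quiet_at /flushes_at /halts_at /=.
case E: (code l) => [||||||||l'|] //= _; first by left; exists l, l'.
by right; exists l.
Qed.

Lemma step_halt a : halts_at a -> pc (stepA a) = None /\ cur (stepA a) = cur a /\
  log (stepA a) = log a /\ clock (stepA a) = (clock a).+1.
Proof. by case: a => pc0 R M u t H [l /= [-> E]]; rewrite E. Qed.

Lemma scout_halt k sc re L T c : halts_at sc -> cur sc = [::] ->
  joint k None sc re L T c ->
  exists c', [/\ reachesB c c', idle k k c', log c' = L,
    clock c' <= T + 3 * (clock (stepA sc) + clock re) &
    pc c' = Some (if k == 1 then Fin false else Next)].
Proof.
move=> [l [pl E]] us [st fr bo h0 h1 m0 m1 hc hu hl ht [ls [le [ps pe pp]]]].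
have [hsz hk hone] := st.
exists (stepB c); move: ps; rewrite pl => -[?]; subst l.
have [|_ [_ [_ ->]]] := @step_halt sc; first by exists ls.
case: c st fr bo h0 h1 m0 m1 hc hu hl ht pp hsz hk hone =>
  pc0 R M u t H /= st fr bo h0 h1 m0 m1 hc hu hl ht -> hsz hk hone.
rewrite /= /sim_code /= E /= hk hone; split=> //=.
- by exists 1; rewrite /= /sim_code /= E /= hk hone.
- by split=> //=; rewrite hc // us /word mod0n.
- lia.
Qed.

(** Strong induction on [J]: the first loud instruction is a [Flush], which completes a cycle, or
    the final [Halt]. *)
Lemma phase J k a L N T c (z := iter J stepA a) :
  pc a <> None -> pc z = None -> cur a = [::] -> cur z = [::] ->
  (forall f, f \in log z -> size f.2 <= n) ->
  (forall i m, size (Defs.mem (iter i stepA a) m) <= s) ->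
  joint k None a a (L ++ N) T c -> all2 (near T) N (keep k (log a)) ->
  exists c' N', [/\ reachesB c c', idle k k c',
    pc c' = Some (if k == 1 then Fin false else Next),
    log c' = L ++ N' /\ all2 (near T) N' (keep k (log z)) &
    clock c' <= T + 6 * clock z].
Proof.
have [m] := ubnP J; elim: m J a N c @z => // m IH J a N c /= Jm.
move=> pa pz ua uz sz bd Jt HN.
have [d [dJ q nq pd]] := first_loud pz pa.
case: (loud_cases pd nq) => [fl|ha].
  have [ua' la'] := step_flush fl.
  have zE : iter J stepA a = iter (J - d.+1) stepA (iter d.+1 stepA a).
    by rewrite -iterD subnK.
  have su : size (cur (iter d stepA a)) <= n.
    (* The set being completed occurs in the final log, whose sets have at most [n] elements. *)
    apply: (sz (clock (iter d.+1 stepA a), cur (iter d stepA a))).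
    have [_ sub _] := run_mono d.+1 pz; apply: sub.
    by rewrite /= la' mem_rcons mem_head.
  have [c1 [N1 [r1 J1 H1]]] := cycle q fl su bd ua Jt HN.
  have lt : J - d.+1 < m by lia.
  have p1 : pc (iter d.+1 stepA a) <> None by have [ls [? []]] := joint_pc J1 => ->.
  have b1 i m' : size (Defs.mem (iter i stepA (iter d.+1 stepA a)) m') <= s.
    by rewrite -iterD.
  rewrite zE in pz uz sz *.
  have [c2 [N2 [r2 i2 p2 l2 t2]]] := IH _ _ _ _ lt p1 pz ua' uz sz b1 J1 H1.
  by exists c2, N2; split=> //; apply: reaches_trans r2.
have [ph [uh [lh th]]] := step_halt ha.
have zE : iter J stepA a = stepA (iter d stepA a).
  by apply: (@iter_halted_eq _ _ _ J d.+1).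
have [c1 r1 /= J1] := joint_run (md := None) q bd Jt.
have [|c2 [r2 i2 l2 t2 p2]] := scout_halt ha _ J1; first by rewrite -uh -zE.
exists c2, N; split=> //; first exact: reaches_trans r2.
  by split=> //; rewrite zE lh (iter_quiet q).
(* At the halt the replay is still at [a], whose clock is at most that of [z]. *)
have [_ _ mono] := run_mono 0 pz.
by apply: leq_trans t2 _; rewrite zE in mono *; move: mono => /=; lia.
Qed.

(** * Resetting both copies between phases *)

Lemma mirrors_mem_blank k b M : 0 < k -> fresh k.+1 M ->
  mirrors_mem k b [ffun=> [::]] M.
Proof.
move=> k0 fr m i; rewrite ffunE nth_nil.
(* A stamp equal to [k] is impossible: it is neither 0, as [k > 0], nor at least [k.+1]. So all
   cells read as 0 without being cleared. *)
case: eqP => // e; case: (fr b m i); rewrite e; first by move: k0 => /[swap] ->.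
by rewrite ltnn.
Qed.

Definition reset_val k (r : reg A) := regs (@init A w [:: n; k]) r.

Lemma reset_loop k D c : k <= n -> pc c = Some (Reset D) ->
  (forall d r, (d, r) \notin D -> regs c (inl (d, r)) = reset_val k r) ->
  idle k k.+1 c ->
  exists c', [/\ reachesB c c', idle k k.+1 c',
    pc c' = Some (Sim None (start A) (start A) (false, false)),
    forall d r, regs c' (inl (d, r)) = reset_val k r &
    log c' = log c /\ clock c' = clock c + #|D|.+1].
Proof.
move=> kn; have [m] := ubnP #|D|; elim: m D c => // m IH D c Dm pD hD.
case: c pD hD => pc0 R M u T H /= -> hD [/= st fr bo hc hu].
have [hsz hk hone] := st.
set c0 := Config _ _ _ _ _ _.
have s1 : stepB c0 = match [pick dr in D] with
    | Some dr => @Config B (Some (Reset (D :\ dr)))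
                   (upd R (inl dr) (reset_val k dr.2)) M u T.+1 H
    | None => @Config B (Some (Sim None (start A) (start A) (false, false)))
                   (upd R (aux Stamp) (word w 0)) M u T.+1 H
    end.
  rewrite /= /reset_code /reset_val /=; case: pickP => [dr _|_] //=.
  rewrite ffunE /=; case: eqP => _ /=; first by rewrite hsz hone muln1.
  by case: eqP => _ /=; rewrite ?hk ?hone ?muln1.
case: pickP s1 => [[d r] dD|D0] s1.
  have [||||c' [r' i' p' h' [l' t']]] := IH (D :\ (d, r)) (stepB c0).
  - by move: Dm; rewrite (cardsD1 (d, r) D) dD add1n ltnS.
  - by rewrite s1.
  - move=> d' r''; rewrite s1 /= !inE negb_and negbK updE.
    case/orP => [/eqP [-> ->]|ne]; first by rewrite eqxx.
    by case: eqP => [[_ ->] //|_]; apply: hD.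
  - by rewrite s1; split=> //=; [exact: steady_upd|rewrite upd_other].
  exists c'; split=> //; first exact: reaches_trans (reaches_step _ _ _) r'.
  by rewrite l' t' s1 /=; split=> //; rewrite (cardsD1 (d, r) D) dD add1n !addnS.
exists (stepB c0); split; first exact: reaches_step.
- by rewrite s1; split=> //=; [exact: steady_stamp|rewrite upd_other].
- by rewrite s1.
- move=> d r; rewrite s1 /= updE; apply: hD.
  by apply/negP => dD; move: (D0 (d, r)); rewrite /= dD.
rewrite s1 (_ : #|D| = 0) ?addn1 //.
by apply/eqP; rewrite cards_eq0; apply/eqP/setP => dr; rewrite inE; apply: D0.
Qed.

Lemma reset_run k c (T := clock c + #|{: bool * reg A}|.+1) :
  1 <= k <= n -> pc c = Some (Reset setT) -> idle k k.+1 c ->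
  exists2 c', reachesB c c' &
    joint k None (init A w [:: n; k]) (init A w [:: n; k]) (log c) T c'.
Proof.
case/andP=> k0 kn pc0 ic.
have [|c' [r' [st fr bo hc hu] p' h' [l' t']]] := reset_loop kn pc0 _ ic.
  by move=> d r; rewrite inE.
exists c' => //; split=> //.
- by move=> b m i; case: (fr b m i) => [->|]; [left|right; lia].
- exact: mirrors_mem_blank.
- exact: mirrors_mem_blank.
- by rewrite hc /= /word mod0n.
- by rewrite t' /T cardsT leq_addr.
- by exists (start A), (start A).
Qed.

(** * Time accounting over the phases *)

Lemma halted_clock a J : pc a <> None -> pc (iter J stepA a) = None ->
  clock a < clock (iter J stepA a).
Proof.
case: J => [|J] //; rewrite iterSr => pa _.
have [_ _] := iter_mono w x J (stepA a); apply: leq_trans.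
by case: a pa => [[l|]] R M u T H //= _; case: (code l).
Qed.

Variables (F : {set {set 'I_n}}) (t : nat).
Hypothesis A_enumerates : forall k, 1 <= k <= n ->
  enumerates_within A w x [:: n; k] (at_least k F) t s.

(** Halting itself costs an instruction, so a run with all gaps 0 is impossible. *)
Lemma t_gt0 : 0 < t.
Proof.
have [|z [Xs [[[J zE] pz _] _ dz _]]] := A_enumerates (k := n); first by lia.
have [_] := delay_bounds dz; have := @halted_clock (init A w [:: n; n]) J.
rewrite -zE => /(_ _ pz) zgt zle; have {}zgt : 0 < clock z by apply: zgt.
by move: (leq_trans zgt zle); rewrite muln_gt0 => /andP[].
Qed.

Local Notation size_at_least k := #|at_least k F|.
Local Notation overhead := (#|{: bool * reg A}|.+4.+4).

Definition progress k c := exists Ys, [/\ all2 (@spells n) [seq e.2 | e <- log c] Ys,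
  perm_eq Ys (enum (at_least k F)), nonincreasing_card Ys &
  forall i, i < size (log c) ->
    nth 0 (out_times c) i <= overhead * (n.+1 * (i.+1 * t))].

(** Time allowed before phase [k]: each of the [n - k] earlier runs found at most
    [size_at_least k.+1] sets, and one further share pays for booting. *)
Definition budget k := overhead * ((n.+1 - k) * ((size_at_least k.+1).+1 * t)).

Lemma at_leastS k : size_at_least k.+1 <= size_at_least k.
Proof.
by apply/subset_leq_card/subsetP => X; rewrite !mem_at_least => /andP[-> /ltnW].
Qed.

(** The constant splits as [e.+2 + 6]: 6 for simulating, [e.+2] for resetting [e] registers with
    strict inequality. The slack pays for the instruction at [Next]. *)
Lemma budget_step e u v a b : u < v -> a <= b -> 0 < b ->
  e.+4.+4 * (u * a) + e.+1 + 6 * b < e.+4.+4 * (v * b).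
Proof.
move=> uv ab b0; apply: (@leq_trans (e.+4.+4 * (u * b + b))).
  rewrite mulnDr -addnA -addnS leq_add ?leq_mul2l ?ab ?orbT //.
  rewrite (_ : e.+4.+4 = e.+2 + 6) ?mulnDl; last by lia.
  by rewrite -addSn leq_add // leq_pmulr.
by rewrite addnC -mulSn leq_mul2l leq_mul2r uv !orbT.
Qed.

Lemma near_snd T N K : all2 (near T) N K -> [seq e.2 | e <- N] = [seq e.2 | e <- K].
Proof.
by elim: N K => [|e N IH] [|f K] //= /andP[/andP[/eqP -> _] /IH ->].
Qed.

Lemma near_fst T N K i : all2 (near T) N K -> i < size N ->
  nth 0 [seq e.1 | e <- N] i <= T + 6 * (nth (0, [::]) K i).1.
Proof.
elim: N K i => [|e N IH] [|f K] [|i] //= /andP[/andP[_ h] h'] //.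
by rewrite ltnS; apply: IH.
Qed.

Lemma phase_progress k c : 1 <= k <= n -> pc c = Some (Reset setT) ->
  idle k k.+1 c -> progress k.+1 c -> clock c <= budget k ->
  exists c', [/\ reachesB c c', idle k k c',
    pc c' = Some (if k == 1 then Fin false else Next), progress k c' &
    clock c' < budget k.-1].
Proof.
move=> kn pcc ic [Ys [Yl Yp Ys_sorted Yt]] cb.
have [z [Xs [[[J zE] pz uz] /andP[zX Xp] dz sz]]] := A_enumerates kn.
have [c1 r1 J1] := reset_run kn pcc ic.
have [zt zc] := delay_bounds dz.
have szX : size (log z) = size_at_least k.
  by rewrite cardE -(perm_size Xp); move: zX; rewrite all2E size_map => /andP[/eqP].
have szY : size (log c) = size_at_least k.+1.
  by rewrite cardE -(perm_size Yp); move: Yl; rewrite all2E size_map => /andP[/eqP].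
have su : forall f, f \in log z -> size f.2 <= n.
  move=> f /(map_f snd) fz; have := zX; rewrite all2E => /andP[/eqP es /allP az].
  have fi : index f.2 [seq e.2 | e <- log z] < size [seq e.2 | e <- log z].
    by rewrite index_mem.
  have := az (nth ([::], set0) (zip [seq e.2 | e <- log z] Xs)
    (index f.2 [seq e.2 | e <- log z])).
  rewrite mem_nth ?size_zip ?es ?minnn -?es // nth_zip //= nth_index // => /(_ isT).
  by move/spells_size ->; rewrite -[n in _ <= n]card_ord max_card.
have bd i m : size (Defs.mem (iter i stepA (init A w [:: n; k])) m) <= s.
  rewrite zE in pz sz; have [h _ _] := run_mono i pz.
  apply: leq_trans (h m) _; apply: leq_trans sz; rewrite /space (bigD1 m) //=; lia.
rewrite -[log c]cats0 in J1.
rewrite zE in pz uz su.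
have [//|c2 [N [r2 i2 p2 [l2 HN] t2]]] :=
  phase _ pz (erefl : cur (init A w [:: n; k]) = [::]) uz su bd J1 isT.
rewrite -zE in HN t2 pz uz su.
have kp : 0 < k by case/andP: kn.
have q : perm_eq (Ys ++ [seq X : {set 'I_n} <- Xs | #|X| == k]) (enum (at_least k F)).
  exact: perm_at_least.
(* The sets that [A(k)] finds in vain are exactly those output in the earlier phases. *)
have cnt : count (fun f : nat * seq nat => size f.2 != k) (log z) = size (log c).
  have := perm_size q; rewrite -(perm_size Xp) size_cat size_filter.
  rewrite -(count_predC (fun X : {set 'I_n} => #|X| == k) Xs) addnC => /addnI.
  rewrite -(all2_spells_count _ zX) count_map szY cardE -(perm_size Yp).
  by move=> ->.
exists c2; split=> //.
- exact: reaches_trans r2.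
- exists (Ys ++ [seq X : {set 'I_n} <- Xs | #|X| == k]); split=> //.
  + rewrite l2 map_cat all2_cat // (near_snd HN).
    by have := all2_spells_filter k zX; rewrite filter_map.
  + apply: (@nonincreasing_cat _ k) => // X.
      by rewrite (perm_mem Yp) mem_enum mem_at_least => /andP[_ /ltnW].
    by rewrite mem_filter => /andP[/eqP].
  + move=> i; rewrite l2 size_cat /out_times l2 map_cat nth_cat size_map => iN.
    case: ltnP => ci; first exact: Yt.
    have jN : i - size (log c) < size N by lia.
    apply: leq_trans (near_fst HN jN) _.
    (* Output [i] has position [p <= i] in the log of [A(k)], hence takes [A(k)] time at most
       [i.+1 * t]. The earlier phases fit too, as [size_at_least k.+1 <= i]. *)
    have [|p pz' [pi ->]] := @nth_filter _ (0, [::])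
      (fun f : nat * seq nat => size f.2 == k) (log z) (i - size (log c)).
      by move: HN jN; rewrite all2E => /andP[/eqP -> _]; rewrite size_filter.
    have pc' : p <= i by move: pi; rewrite /= cnt; lia.
    have := zt p pz'; rewrite /out_times (nth_map (0, [::])) // => pt.
    apply: ltnW; apply: leq_ltn_trans (@budget_step #|{: bool * reg A}| (n.+1 - k) n.+1
      ((size_at_least k.+1).+1 * t) (i.+1 * t) _ _ _).
    + rewrite leq_add ?leq_add2r // leq_mul2l /=.
      by apply: leq_trans pt _; rewrite leq_mul2r ltnS pc' orbT.
    + lia.
    + by rewrite leq_mul2r ltnS -szY ci orbT.
    + by rewrite muln_gt0 t_gt0.
apply: leq_ltn_trans t2 _.
apply: leq_ltn_trans (@budget_step #|{: bool * reg A}| (n.+1 - k) (n.+1 - k.-1)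
      ((size_at_least k.+1).+1 * t) ((size_at_least k.-1.+1).+1 * t) _ _ _).
- rewrite leq_add ?leq_add2r // leq_mul2l /= prednK //.
  by rewrite -szX.
- lia.
- by rewrite leq_mul2r ltnS prednK // at_leastS orbT.
- by rewrite muln_gt0 t_gt0.
Qed.

(** Only [Card] changes: the same stamps that were current for [k] are outdated for [k.-1]. *)
Lemma next_run k c : 1 < k <= n -> pc c = Some Next -> idle k k c ->
  exists c', [/\ reachesB c c', idle k.-1 k.-1.+1 c', pc c' = Some (Reset setT),
    log c' = log c & clock c' = (clock c).+1].
Proof.
case/andP=> k1 kn pn [st fr bo hc hu]; have [hsz hk hone] := st.
exists (stepB c); have := reaches_step w x c.
case: c pn st fr bo hc hu hsz hk hone => pc0 R M u T H /= -> st fr bo hc hu hsz hk hone.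
split=> //; split=> //=; rewrite ?upd_other ?prednK //; last by lia.
split; [by rewrite upd_other | | by rewrite upd_other].
by rewrite upd_same hk hone subn1 word_small //; lia.
Qed.

Lemma all_phases k c : 1 <= k <= n -> pc c = Some (Reset setT) ->
  idle k k.+1 c -> progress k.+1 c -> clock c <= budget k ->
  exists c', [/\ reachesB c c', idle 1 1 c', pc c' = Some (Fin false), progress 1 c' &
    clock c' < budget 0].
Proof.
elim: k c => // k IH c kn pcc ic pr cb.
have [c1 [r1 i1 p1 pr1 t1]] := phase_progress kn pcc ic pr cb.
case: k IH kn ic pr cb i1 p1 pr1 t1 => [|k] IH kn ic pr cb i1 p1 pr1 t1.
  by exists c1.
have [|c2 [r2 i2 p2 l2 t2]] := next_run _ p1 i1; first by lia.
have [|||c3 [r3 i3 p3 pr3 t3]] := IH c2 _ p2 i2.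
- lia.
- by move: pr1; rewrite /progress /out_times l2.
- by rewrite t2.
exists c3; split=> //.
exact/(reaches_trans r1)/(reaches_trans r2).
Qed.

(** * Start, final empty set, and assembly *)

Lemma boot_run : exists c, [/\ reachesB (init B w [:: n]) c, idle n n.+1 c,
  pc c = Some (Reset setT), log c = [::] & clock c = 2].
Proof.
have w1 : word w 1 = 1 by apply: word_small; lia.
have wn : word w n = n by apply: word_small.
exists (iter 2 stepB (init B w [:: n])); split=> //=; first by exists 2.
have E : upd [ffun r : enum_reg => word w (if r == aux Size then n else
    if r == aux Size then 0 else 0)] (aux One) (word w 1) (aux Size) = n.
  by rewrite upd_other // ffunE eqxx.
split=> //=.
- split; last by rewrite upd_other // upd_same.
    by rewrite upd_other.
  by rewrite upd_same E upd_same w1 muln1.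
- by move=> b m i; left; rewrite ffunE nth_nil.
- by move=> q; rewrite ffunE.
- by rewrite !upd_other // ffunE /= /word mod0n.
Qed.

Definition final_log c : seq (nat * seq nat) :=
  if empty then [:: ((clock c).+1, [::])] else [::].

Lemma fin_run c : pc c = Some (Fin false) -> cur c = [::] ->
  exists c', [/\ reachesB c c', pc c' = None, cur c' = [::],
    log c' = log c ++ final_log c & Defs.mem c' = Defs.mem c].
Proof.
case: c => pc0 R M u T H /= -> ->; rewrite /final_log.
exists (iter 2 stepB (@Config B (Some (Fin false)) R M [::] T H)).
split; first (by exists 2); rewrite /=; case: (empty); rewrite /= ?cats1 ?cats0 //.
Qed.

Lemma enumerator_correct : empty = (set0 \in F) ->
  exists (c : config B) (Xs : seq {set 'I_n}),
    [/\ terminates w x [:: n] c, outputs c F Xs, nonincreasing_card Xs,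
      forall i, 1 <= i <= #|F| ->
        nth 0 (out_times c) i.-1 <= overhead * (n.+1 * (i * t)) &
      bounded (Defs.mem c)].
Proof.
move=> eF; have [c0 [r0 i0 p0 l0 t0]] := boot_run.
have [|||c1 [r1 i1 p1 [Ys [Yl Yp Ys_sorted Yt]] t1]] := all_phases (k := n) _ p0 i0.
- lia.
- exists [::]; rewrite l0; split=> //.
  (* No subset of ['I_n] has more than [n] elements, so nothing is due before phase [n]. *)
  rewrite (_ : at_least n.+1 F = set0) ?enum_set0 //.
  apply/setP => X; rewrite mem_at_least inE ltnNge.
  by rewrite -[n in _ <= n]card_ord max_card andbF.
- rewrite t0 /budget subSnn mul1n.
  apply: (@leq_trans (overhead * 1)); first by rewrite muln1.
  by rewrite leq_mul2l muln_gt0 t_gt0 orbT.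
have szY : size (log c1) = size_at_least 1.
  by rewrite cardE -(perm_size Yp); move: Yl; rewrite all2E size_map => /andP[/eqP].
have [c2 [r2 p2 u2 l2 m2]] : exists c2, [/\ reachesB c1 c2, pc c2 = None,
    cur c2 = [::], log c2 = log c1 ++ final_log c1 & Defs.mem c2 = Defs.mem c1].
  by case: i1 => _ _ _ _; apply: fin_run.
exists c2, (Ys ++ if empty then [:: set0] else [::]).
have Fsplit : F = at_least 1 F :|: (if empty then [set set0] else set0).
  apply/setP => X; rewrite inE mem_at_least card_gt0.
  have [->|X0] := eqVneq X set0.
    by rewrite -eF andbF /=; case: (empty); rewrite inE ?eqxx.
  by case: (empty); rewrite andbT inE ?(negPf X0) orbF.
have cF : #|F| = size_at_least 1 + empty.
  rewrite [in LHS]Fsplit; case: (empty); rewrite ?setU0 ?addn0 //.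
  by rewrite setUC cardsU1 mem_at_least cards0 andbF addnC.
split.
- split=> //.
  by have [j ->] := reaches_trans (reaches_trans r0 r1) r2; exists j.
- apply/andP; split.
    rewrite l2 map_cat all2_cat // /final_log.
    move: (clock c1) => T1; case: (empty) => //=.
    by rewrite /spells enum_set0.
  apply: uniq_perm; rewrite ?enum_uniq // ?cat_uniq.
    rewrite (perm_uniq Yp) enum_uniq; case: (empty) => //=.
    by rewrite (perm_mem Yp) mem_enum mem_at_least cards0 andbF.
  move=> X; rewrite mem_cat (perm_mem Yp) !mem_enum [in RHS]Fsplit inE.
  by case: (empty); rewrite !inE.
- apply: (@nonincreasing_cat _ 0) => // X.
  by case: (empty); rewrite // inE => /eqP ->; rewrite cards0.
- case=> // i /andP[_ iF]; rewrite /out_times l2 map_cat nth_cat size_map /=.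
  case: ltnP => ci; first exact: Yt.
  (* Past the phases only the empty set remains; it is output one step after [clock c1 < budget 0],
     which is the bound required at this index. *)
  have [-> e1] : i = size (log c1) /\ empty.
    by move: (log c1) szY ci iF => H1; rewrite cF => <-; case: (empty); lia.
  rewrite /final_log subnn szY; move: (clock c1) t1 => T1.
  by rewrite e1 /budget subn0.
- by rewrite m2; case: i1.
Qed.

End Correctness.
End Enumerator.

Theorem theorem5 (A : program) :
  exists (B : bool -> program) (C : nat),
  forall (n w : nat) (x : seq nat) (F : {set {set 'I_n}}) (t s : nat -> nat),
    0 < n -> n < 2 ^ w ->
    (forall k : nat, 1 <= k <= n ->
       enumerates_within A w x [:: n; k] (at_least k F) (t n) (s n)) ->
    exists (c : config (B (set0 \in F))) (Xs : seq {set 'I_n}),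
      [/\ terminates w x [:: n] c,
          outputs c F Xs,
          nonincreasing_card Xs,
          forall i : nat, 1 <= i <= #|F| ->
            nth 0 (out_times c) i.-1 <= C * (i * n * t n)
        & space c <= C * s n].
Proof.
set D := #|{: bool * reg A}|.+4.+4.
(* The factor 2 absorbs [n.+1 <= 2 * n]; the other summands bound the space, each array having at
   most [s n] cells. *)
exists (enumerator A), (2 * D + #|enum_reg A| + #|enum_arr A|) => n w x F t s n0 nw HA.
have [c [Xs [ct co cs ctime cspace]]] := enumerator_correct n0 nw HA erefl.
exists c, Xs; split=> // [i /ctime ti|].
  apply: leq_trans ti _; apply: (@leq_trans (2 * D * (i * n * t n))).
    rewrite [2 * D]mulnC -mulnA leq_mul2l; apply/orP; right.
    rewrite (_ : 2 * _ = 2 * n * (i * t n)); last first.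
      by rewrite -!mulnA [n * (i * _)]mulnCA.
    by rewrite leq_mul2r; apply/orP; right; lia.
  by rewrite leq_mul2r -addnA leq_addr orbT.
(* [A] has at least the register [arg0 A], so [s n] is positive and the constant number of registers
   fits into a multiple of it. *)
have s_gt0 : 0 < s n.
  have [|z [Xs' [_ _ _ sz]]] := HA n; first by lia.
  apply: leq_trans sz; rewrite addn_gt0; apply/orP; left.
  by apply/card_gt0P; exists (arg0 A).
rewrite /space; apply: (@leq_trans ((#|enum_reg A| + #|enum_arr A|) * s n)).
  rewrite mulnDl leq_add ?leq_pmulr // -sum_nat_const; exact: leq_sum.
by rewrite leq_mul2r -addnA leq_addl orbT.
Qed.
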